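(* Let $a_2,a_3,b_2,b_3$ be nonzero real numbers satisfying one of the following conditions: (I) $a_2b_3\neq a_3b_2$ and $a_2b_2\neq -a_3b_3$; (II) $a_2b_3=a_3b_2$ and $|a_2|\neq|a_3|$; (III) $a_2b_3=a_3b_2$ and $a_2=a_3$. Let $\xi_1,\xi_2,\xi_3,\xi_4$ be independent real-valued random variables whose characteristic functions vanish nowhere on $\mathbb{R}$, with $\xi_2$ and $\xi_3$ identically distributed, and put $L_1=\xi_1+a_2\xi_2+a_3\xi_3$, $L_2=b_2\xi_2+b_3\xi_3+\xi_4$. Let $\eta_1,\eta_2,\eta_3,\eta_4$ be any independent real-valued random variables whose characteristic functions vanish nowhere, with $\eta_2$ and $\eta_3$ identically distributed, and put $M_1=\eta_1+a_2\eta_2+a_3\eta_3$, $M_2=b_2\eta_2+b_3\eta_3+\eta_4$. If $(L_1,L_2)$ and $(M_1,M_2)$ have the same distribution, then there exist real numbers $\alpha_1,\dots,\alpha_4$ such that for each $j=1,2,3,4$ the distribution of $\eta_j$ equals that of $\xi_j+\alpha_j$. *)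

(* Defs.v *)
From HB Require Import structures.
From mathcomp Require Import all_boot all_order all_algebra.
From mathcomp Require Import all_classical all_reals all_analysis.
From mathcomp Require Import complex.
Set Implicit Arguments. Unset Strict Implicit. Unset Printing Implicit Defensive.
Import Order.TTheory GRing.Theory Num.Theory.
Local Open Scope classical_set_scope.
Local Open Scope ring_scope.

Definition same_law d d' dV (T : measurableType d) (T' : measurableType d')
    (V : measurableType dV) (R : realType)
    (P : probability T R) (Q : probability T' R) (X : T -> V) (Y : T' -> V) :=
  forall A : set V, measurable A -> P (X @^-1` A) = Q (Y @^-1` A).

(* Mutual independence of four real random variables on (T,P):
   P(X1 \in B1, ..., X4 \in B4) = prod_i P(Xi \in Bi) for all Borel Bi
   (taking some Bi = R gives the product rule for every subfamily). *)
Definition mutually_indep4 d (T : measurableType d) (R : realType)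
    (P : probability T R) (X1 X2 X3 X4 : T -> R) :=
  forall B1 B2 B3 B4 : set R,
    measurable B1 -> measurable B2 -> measurable B3 -> measurable B4 ->
    P (X1 @^-1` B1 `&` X2 @^-1` B2 `&` X3 @^-1` B3 `&` X4 @^-1` B4) =
    (P (X1 @^-1` B1) * P (X2 @^-1` B2) * P (X3 @^-1` B3) * P (X4 @^-1` B4))%E.

Definition charfun d (T : measurableType d) (R : realType)
    (P : probability T R) (X : T -> R) (t : R) : R[i] :=
  (Rintegral P setT (fun x => cos (t * X x)) +i*
   Rintegral P setT (fun x => sin (t * X x)))%C.

Definition charfun_nowhere_zero d (T : measurableType d) (R : realType)
    (P : probability T R) (X : T -> R) :=
  forall t : R, charfun P X t != 0.

(* Main.v *)
(* The ratios h_j of the characteristic functions of eta_j and xi_j satisfy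
     h_1(u) h_2(a2 u + b2 v) h_2(a3 u + b3 v) h_4(v) = 1,
   and it suffices to show h_2(t) = e^{ict}: putting u = 0 or v = 0 then determines h_1 and h_4,
   and the uniqueness theorem for characteristic functions concludes.

   If a2 b3 = a3 b2, the map w |-> h_2(a2 w) h_2(a3 w) is a continuous unit character e^{icw}; when
   a2 = a3 one extracts a continuous square root, and when |a2| <> |a3| the function
   m(t) = h_2(t) e^{-ict/(a2+a3)} satisfies m(t) = m(r^2 t) with |r| < 1, so m = 1.
   Otherwise the third multiplicative differences of h_2 are trivial.  Hence ln |h_2|^2 is a quadratic
   form, which vanishes because a2 b2 + a3 b3 <> 0 (compare v and -v), and then h_2^2 is a character.

   Uniqueness theorem: equality of characteristic functions gives equality of the expectations of
   p(sin(sX + c)) for every polynomial p, then of the indicators of {sin(sX + c) > 0} by bounded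
   limits, and finally of {X > a} by letting s -> 0 with c = -sa. *)
Require Import Defs.
From HB Require Import structures.
From mathcomp Require Import all_boot all_order all_algebra.
From mathcomp Require Import all_classical all_reals all_analysis.
From mathcomp Require Import measurable_realfun complex ring lra.
Import Order.TTheory GRing.Theory Num.Theory.
Import numFieldNormedType.Exports.
Local Open Scope classical_set_scope.
Local Open Scope ring_scope.
Set Implicit Arguments. Unset Strict Implicit. Unset Printing Implicit Defensive.

(** * Continuous unit characters of the line *)

(** The integer multiples of [e / 2 ^+ n] lie in [K] and form grids of arbitrarily small mesh.
    Identities between continuous homomorphisms thus reduce to repeated halving. *)
Lemma dyadic_dense (R : realType) (K : set R) (e : R) :
  0 < e -> closed K -> (forall x y, K x -> K y -> K (x - y)) ->
  (forall n, K (e / 2 ^+ n)) -> forall x, K x.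
Proof.
move=> e0 cK subK Kdy x; apply: cK => B /nbhs_ballP[r /= r0 rB].
have [n nr] : exists n, e / 2 ^+ n < r.
  have := @cvg_geometric R e 2^-1.
  rewrite ger0_norm ?invr_ge0// invf_lt1// ltr1n => /(_ isT)/cvgr0_norm_lt/(_ _ r0)[n _ nr].
  exists n; have := nr n (leqnn n) => /=; rewrite exprVn ger0_norm// divr_ge0 ?exprn_ge0//.
  exact: ltW.
set y := e / 2 ^+ n in nr; have y0 : 0 < y by rewrite divr_gt0// exprn_gt0.
have K0 : K 0 by rewrite -(subrr y); apply: subK; exact: Kdy.
have KN z : K z -> K (- z) by move=> Kz; rewrite -sub0r; exact: subK.
have Kn (m : nat) : K (m%:R * y).
  elim: m => [|m IH]; first by rewrite mul0r.
  by rewrite -natr1 mulrDl mul1r -[X in _ + X]opprK; apply: subK => //; exact/KN/Kdy.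
have Kz (m : int) : K (m%:~R * y).
  case: m => m; first exact: Kn.
  by rewrite NegzE mulrNz mulNr; apply: KN; exact: Kn.
(* The grid point just below [x] is at distance less than [y], hence less than [r]. *)
exists ((Num.floor (x / y))%:~R * y); split; first exact: Kz.
apply: rB; rewrite /ball/= ger0_norm.
  apply: le_lt_trans nr.
  rewrite lerBlDr -{1}(mul1r y) -mulrDl -ler_pdivrMr// addrC.
  by have := ltW (lt_succ_floor (x / y)); rewrite intrD.
by rewrite subr_ge0 -ler_pdivlMr// floor_le_tmp.
Qed.

Definition cis (R : realType) (c t : R) : R[i] := (cos (c * t) +i* sin (c * t))%C.

(** Stated by components, so that limit and intermediate value theorems for real functions apply
    directly. *)
Definition ccontinuous (R : realType) (f : R -> R[i]) :=
  continuous (fun t => complex.Re (f t)) /\ continuous (fun t => complex.Im (f t)).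

(** The squared modulus, valued in [R] so that [ln] and the real order are available. *)
Definition sqnorm (R : realType) (z : R[i]) : R := complex.Re z ^+ 2 + complex.Im z ^+ 2.

Lemma sqnormM (R : realType) (z w : R[i]) : sqnorm (z * w) = sqnorm z * sqnorm w.
Proof. by case: z w => [a b] [c d]; rewrite /sqnorm/=; ring. Qed.

Lemma sqnorm_gt0 (R : realType) (z : R[i]) : z != 0 -> 0 < sqnorm z.
Proof.
case: z => [a b]; rewrite eq_complex /sqnorm/= => ab.
by rewrite lt_neqAle addr_ge0 ?sqr_ge0// andbT eq_sym paddr_eq0 ?sqr_ge0// !sqrf_eq0.
Qed.

Lemma mulc_conj (R : realType) (z : R[i]) : z * conjc z = (sqnorm z)%:C%C.
Proof. by case: z => [a b]; rewrite /sqnorm; simpc; congr (_ +i* _)%C; ring. Qed.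

Lemma cisD (R : realType) (c s t : R) : cis c (s + t) = cis c s * cis c t.
Proof.
rewrite /cis mulrDr cosD sinD; simpc; congr (_ +i* _)%C; ring.
Qed.

Lemma cisDl (R : realType) (c c' t : R) : cis (c + c') t = cis c t * cis c' t.
Proof.
rewrite /cis mulrDl cosD sinD; simpc; congr (_ +i* _)%C; ring.
Qed.

Lemma cis0 (R : realType) (c : R) : cis c 0 = 1.
Proof. by rewrite /cis mulr0 cos0 sin0. Qed.

Lemma cis_0 (R : realType) (t : R) : cis 0 t = 1.
Proof. by rewrite /cis mul0r cos0 sin0. Qed.

Lemma cisN (R : realType) (c t : R) : cis c t * cis (- c) t = 1.
Proof. by rewrite -cisDl subrr cis_0. Qed.

Lemma cisMx (R : realType) (c a t : R) : cis c (a * t) = cis (c * a) t.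
Proof. by rewrite /cis mulrA. Qed.

Lemma ccontinuous_cis (R : realType) (c : R) : ccontinuous (cis c).
Proof.
split => t /=; apply: continuous_comp; try exact: mulrl_continuous.
  exact: continuous_cos.
exact: continuous_sin.
Qed.

Lemma ccontinuousM (R : realType) (f g : R -> R[i]) :
  ccontinuous f -> ccontinuous g -> ccontinuous (fun t => f t * g t).
Proof.
move=> [f1 f2] [g1 g2]; split => t.
  have -> : (fun t => complex.Re (f t * g t)) =
    (fun t => complex.Re (f t) * complex.Re (g t) - complex.Im (f t) * complex.Im (g t)).
    by apply/funext => x; case: (f x) (g x) => [a b] [].
  by apply: cvgB; apply: cvgM; [exact: f1|exact: g1|exact: f2|exact: g2].
have -> : (fun t => complex.Im (f t * g t)) =
    (fun t => complex.Re (f t) * complex.Im (g t) + complex.Im (f t) * complex.Re (g t)).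
  by apply/funext => x; case: (f x) (g x) => [a b] [].
by apply: cvgD; apply: cvgM; [exact: f1|exact: g2|exact: f2|exact: g1].
Qed.

Lemma sqnorm_continuous (R : realType) (f : R -> R[i]) :
  ccontinuous f -> continuous (fun t => sqnorm (f t)).
Proof.
move=> [f1 f2] t; rewrite /sqnorm.
by apply: cvgD; apply: (@cvgM _ _ (nbhs t)); [exact: f1|exact: f1|exact: f2|exact: f2].
Qed.

Lemma ccontinuousV (R : realType) (f : R -> R[i]) :
  (forall t, f t != 0) -> ccontinuous f -> ccontinuous (fun t => (f t)^-1).
Proof.
move=> f0 fc; have [f1 f2] := fc; split => t.
  have -> : (fun t => complex.Re (f t)^-1) = (fun t => complex.Re (f t) * (sqnorm (f t))^-1).
    by apply/funext => x; case: (f x) => [a b].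
  apply: cvgM; first exact: f1.
  by apply: cvgV; [rewrite gt_eqF// sqnorm_gt0|exact: sqnorm_continuous].
have -> : (fun t => complex.Im (f t)^-1) = (fun t => - (complex.Im (f t) * (sqnorm (f t))^-1)).
  by apply/funext => x; case: (f x) => [a b].
apply: cvgN; apply: cvgM; first exact: f2.
by apply: cvgV; [rewrite gt_eqF// sqnorm_gt0|exact: sqnorm_continuous].
Qed.

Lemma ccontinuous_scale (R : realType) (f : R -> R[i]) (a : R) :
  ccontinuous f -> ccontinuous (fun t => f (a * t)).
Proof.
move=> [f1 f2]; split => t.
  apply: (@continuous_comp _ _ _ (fun t => a * t) (fun t => complex.Re (f t))).
    exact: mulrl_continuous.
  exact: f1.
apply: (@continuous_comp _ _ _ (fun t => a * t) (fun t => complex.Im (f t))).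
  exact: mulrl_continuous.
exact: f2.
Qed.

Lemma closed_ccontinuous_eq (R : realType) (f : R -> R[i]) (w : R[i]) :
  ccontinuous f -> closed [set t | f t = w].
Proof.
move=> [f1 f2].
have -> : [set t | f t = w] = (fun t => complex.Re (f t)) @^-1` [set complex.Re w] `&`
    (fun t => complex.Im (f t)) @^-1` [set complex.Im w].
  apply/seteqP; split => t /=; first by move=> ->.
  by move=> [? ?]; apply/eqP; rewrite eq_complex; apply/andP; split; apply/eqP.
by apply: closedI; (apply: preimage_closed; [move=> x _; done|exact: closed_eq]).
Qed.

(** An angle is read off at one small [e]. Halving determines [chi (e / 2 ^+ n)] up to sign,
    positivity of the real part near 0 fixes the sign, and density of the dyadic grid does the
    rest. *)
Lemma unit_character_cis (R : realType) (chi : R -> R[i]) :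
  ccontinuous chi -> (forall s t, chi (s + t) = chi s * chi t) ->
  (forall t, sqnorm (chi t) = 1) -> exists c, forall t, chi t = cis c t.
Proof.
move=> cchi chiD chi1.
have chi_neq0 t : chi t != 0.
  apply/eqP => t0; have := chi1 t; rewrite t0 /sqnorm/= expr0n/= addr0 => /eqP.
  by rewrite eq_sym oner_eq0.
have chi0 : chi 0 = 1.
  by apply: (mulfI (chi_neq0 0)); rewrite -chiD addr0 mulr1.
have [e /= e0 He] : exists2 e : R, 0 < e & forall t, `|t| <= e -> 0 < complex.Re (chi t).
  have : \forall t \near (0 : R), 0 < complex.Re (chi t).
    by apply: (cvgr_gt _ (cchi.1 0)); rewrite chi0/=.
  case/nbhs_ballP => r /= r0 Hr; exists (r / 2); first by rewrite divr_gt0.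
  move=> t tr; apply: Hr; rewrite /ball/= sub0r normrN; apply: le_lt_trans tr _.
  by rewrite ltr_pdivrMr// mulr2n mulrDr mulr1 ltrDl.
have Ree : 0 < complex.Re (chi e) by apply: He; rewrite gtr0_norm.
have Im1 : -1 < complex.Im (chi e) < 1.
  rewrite -ltr_norml -(@ltr_pXn2r _ 2)// ?nnegrE// expr1n real_normK ?num_real//.
  by rewrite -(chi1 e) /sqnorm ltrDr exprn_gt0.
have /andP[Im1l Im1r] := Im1.
have Im1w : -1 <= complex.Im (chi e) <= 1 by rewrite !ltW.
(* Since the real part of [chi e] is positive, it equals [cos th], the nonnegative root of
   [1 - sin th ^+ 2]. *)
pose th := asin (complex.Im (chi e)).
have th_pi : `|th| < pi / 2.
  by rewrite ltr_norml asin_ltpi2 ?asin_gtNpi2// ?Im1l ?Im1r ?ltW.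
have chie : chi e = cis (th / e) e.
  rewrite /cis divfK ?gt_eqF// asinK ?in_itv//= cos_asin//.
  have -> : 1 - complex.Im (chi e) ^+ 2 = complex.Re (chi e) ^+ 2.
    by rewrite -(chi1 e) /sqnorm addrK.
  by rewrite sqrtr_sqr gtr0_norm//; case: (chi e).
exists (th / e).
(* The quotient of [chi] by the candidate character is again multiplicative, so [W = 1] defines a
   closed subgroup. *)
pose W t := chi t * cis (- (th / e)) t.
suff W1 t : W t = 1.
  by move=> t; rewrite -[RHS]mul1r -(W1 t) /W -mulrA [X in _ * X]mulrC cisN mulr1.
have WD s u : W (s + u) = W s * W u by rewrite /W chiD cisD; ring.
apply: (@dyadic_dense _ [set t | W t = 1] e) => //.
- by apply: closed_ccontinuous_eq; apply: ccontinuousM => //; exact: ccontinuous_cis.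
- move=> x y /= Wx Wy; have := WD (x - y) y.
  by rewrite subrK Wx Wy mulr1.
move=> n /=; rewrite /W; suff -> : chi (e / 2 ^+ n) = cis (th / e) (e / 2 ^+ n) by exact: cisN.
elim: n => [|n IH]; first by rewrite expr0 divr1.
set y := e / 2 ^+ n.+1.
have yy : e / 2 ^+ n = y + y.
  by rewrite /y exprS invfM; field; rewrite expf_neq0.
(* The squares at [y] agree. The opposite sign would give [chi y] a real part [- cos (th / e * y)],
   negative because the angle is at most [th] in absolute value. *)
move: IH; rewrite yy chiD cisD -!expr2 => /eqP; rewrite eqf_sqr => /predU1P[//|/eqP yN].
have yle : 0 < y <= e.
  rewrite divr_gt0 ?exprn_gt0//= ler_pdivrMr ?exprn_gt0//.
  by rewrite ler_peMr ?exprn_ege1 ?ler1n// ltW.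
have /andP[y0 ye] := yle.
have : 0 < complex.Re (chi y) by apply: He; rewrite gtr0_norm.
rewrite yN /= ltNge; have -> // : - cos (th / e * y) <= 0.
rewrite oppr_le0 ltW//; apply: cos_gt0_pihalf; rewrite -ltr_norml.
apply: le_lt_trans th_pi; rewrite normrM normrM normfV (gtr0_norm e0) (gtr0_norm y0).
by rewrite -mulrA ler_piMr// mulrC ler_pdivrMr// mul1r.
Qed.

(** The only possible values are 1 and -1; a change of sign on the segment from 0 to [t] would force
    the real part to vanish there. *)
Lemma sqrt_one_continuous (R : realType) (m : R -> R[i]) :
  ccontinuous m -> m 0 = 1 -> (forall t, m t ^+ 2 = 1) -> forall t, m t = 1.
Proof.
move=> mc m0 m2 t.
have mE s : m s = 1 \/ m s = -1.
  by have /eqP := m2 s; rewrite -[X in _ == X](expr1n _ 2) eqf_sqr => /orP[]/eqP ->; [left|right].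
case: (mE t) => // mt.
have [s _] : exists2 s, s \in `[0, 1] & complex.Re (m (t * s)) = 0.
  apply: (@IVT _ (fun s => complex.Re (m (t * s)))) => //.
    by apply: continuous_subspaceT => s; exact: (ccontinuous_scale t mc).1.
  by rewrite mulr0 mulr1 m0 mt /= ge_min le_max lerN10 ler01 orbT.
by case: (mE (t * s)) => -> /= /eqP; rewrite ?oppr_eq0 oner_eq0.
Qed.

(** Dividing [h] by [cis (c / 2)] leaves a continuous square root of 1 with value 1 at 0. *)
Lemma sqrt_cis (R : realType) (h : R -> R[i]) (c : R) :
  ccontinuous h -> h 0 = 1 -> (forall t, h t ^+ 2 = cis c t) ->
  forall t, h t = cis (c / 2) t.
Proof.
move=> hc h0 h2 t.
rewrite -[RHS]mul1r -(@sqrt_one_continuous _ (fun t => h t * cis (- (c / 2)) t) _ _ _ t).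
- by rewrite -mulrA [X in _ * X]mulrC cisN mulr1.
- by apply: ccontinuousM => //; exact: ccontinuous_cis.
- by rewrite h0 cis0 mulr1.
move=> s; rewrite exprMn h2 expr2 -cisDl.
have -> : - (c / 2) + - (c / 2) = - c by field.
exact: cisN.
Qed.

(** * Multiplicative and additive functional equations *)

(** Comparing the equation at the four corners of the rectangle with [u] in {0, s} and [v] in {0, t
    / l} eliminates [k1] and [k4]. *)
Lemma collinear_character (F R : fieldType) (k1 K k4 : R -> F) (l : R) :
  l != 0 -> K 0 = 1 -> (forall u v, k1 u * K (u + l * v) * k4 v = 1) ->
  forall s t, K (s + t) = K s * K t.
Proof.
move=> l0 K0 E s t.
have E1 := E s 0; have E2 := E 0 (t / l); have E3 := E s (t / l); have E4 := E 0 0.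
rewrite !mulr0 addr0 in E1 E4; rewrite mulrCA divff// mulr1 add0r in E2.
rewrite mulrCA divff// mulr1 in E3; rewrite addr0 K0 mulr1 in E4.
transitivity (K (s + t) * (k1 s * K s * k4 0) * (k1 0 * K t * k4 (t / l))).
  by rewrite E1 E2 !mulr1.
transitivity (K s * K t * (k1 s * K (s + t) * k4 (t / l)) * (k1 0 * k4 0)); first by ring.
by rewrite E3 E4 !mulr1.
Qed.

(* Alternating product over the cube spanned by three directions of the [(u, v)]-plane, each of
   which freezes the argument of one of the three other factors. *)
Lemma third_difference (F R : fieldType) (a2 a3 b2 b3 : R) (h1 H h4 : R -> F) :
  a2 != 0 -> b2 != 0 -> a2 * b3 != a3 * b2 -> H 0 = 1 ->
  (forall u v, h1 u * H (a2 * u + b2 * v) * H (a3 * u + b3 * v) * h4 v = 1) ->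
  forall r s t, H (r + s + t) * H r * H s * H t = H (r + s) * H (s + t) * H (r + t).
Proof.
move=> a20 b20 D0 H0 E r s t.
pose D := a2 * b3 - a3 * b2; have {}D0 : D != 0 by rewrite subr_eq0.
(* With [u = r * b3 / D + t / a2] and [v = s / b2 - r * a3 / D] one gets
   [a2 * u + b2 * v = r + s + t], while [a3 * u + b3 * v] is free of [r], [u] of [s], and [v] of
   [t]. *)
pose k1 r t := h1 (r * b3 / D + t / a2); pose k4 r s := h4 (s / b2 - r * a3 / D).
pose G s t := H (s * b3 / b2 + t * a3 / a2).
have P r' s' t' x : x = r' + s' + t' -> k1 r' t' * H x * G s' t' * k4 r' s' = 1.
  move=> ->; rewrite -(E (r' * b3 / D + t' / a2) (s' / b2 - r' * a3 / D)).
  by congr (_ * H _ * H _ * _); rewrite ?/D; field; rewrite -?/D ?a20 ?b20 ?D0.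
have nz (x y z w : F) : x * y * z * w = 1 -> [/\ x != 0, y != 0, z != 0 & w != 0].
  move=> xyz; have : x * y * z * w != 0 by rewrite xyz oner_neq0.
  by rewrite !mulf_eq0 !negb_or => /andP[/andP[/andP[]]].
have eqH (x y z w : F) : x * y * z * w = 1 -> y = (x * z * w)^-1.
  move=> xyz; have [x0 _ z0 w0] := nz _ _ _ _ xyz.
  have xzw : x * z * w != 0 by rewrite !mulf_neq0.
  by apply: (mulfI xzw); rewrite divff// -xyz; ring.
have P1 := P r s t _ erefl; have P2 := P r 0 0 r ltac:(ring).
have P3 := P 0 s 0 s ltac:(ring); have P4 := P 0 0 t t ltac:(ring).
have P5 := P r s 0 (r + s) ltac:(ring); have P6 := P 0 s t (s + t) ltac:(ring).
have P7 := P r 0 t (r + t) ltac:(ring); have P8 := P 0 0 0 0 ltac:(ring).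
rewrite H0 mulr1 in P8.
have [n1 _ n3 n4] := nz _ _ _ _ P1; have [m1 _ m3 m4] := nz _ _ _ _ P2.
have [d1 _ d3 d4] := nz _ _ _ _ P3; have [p1 _ p3 p4] := nz _ _ _ _ P4.
rewrite (eqH _ _ _ _ P1) (eqH _ _ _ _ P2) (eqH _ _ _ _ P3) (eqH _ _ _ _ P4).
rewrite (eqH _ _ _ _ P5) (eqH _ _ _ _ P6) (eqH _ _ _ _ P7).
(* The eighth vertex carries no value of [H], as [H 0 = 1]; its equation supplies the factors that
   cancel the remaining [k1], [G] and [k4]. *)
rewrite -[RHS]mulr1 -invr1 -P8; field.
by rewrite n1 n3 n4 m1 m3 m4 d1 d3 d4 p1 p3 p4.
Qed.

(** The zeros of [f x - x * f 1] form a closed subgroup containing 1 and stable under halving. *)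
Lemma continuous_additive_linear (R : realType) (f : R -> R) :
  continuous f -> (forall s t, f (s + t) = f s + f t) -> forall x, f x = x * f 1.
Proof.
move=> fc fD x; apply/eqP; rewrite -subr_eq0; apply/eqP.
have f0 : f 0 = 0 by have /eqP := fD 0 0; rewrite addr0 -subr_eq subrr => /eqP.
apply: (@dyadic_dense _ [set x | f x - x * f 1 = 0] 1) => //.
- apply: (@preimage_closed _ _ (fun x => f x - x * f 1) [set 0]); last exact: closed_eq.
  by move=> y _; apply: cvgB; [exact: fc|apply: cvgM; [exact: cvg_id|exact: cvg_cst]].
- move=> y z /= fy fz; have := fD (y - z) z; rewrite subrK => fyE.
  have -> : f (y - z) = f y - f z by rewrite fyE addrK.
  by rewrite -[RHS](subrr 0) -{1}fy -fz; ring.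
elim => [|n /= IH]; first by rewrite /= expr0 divr1 mul1r subrr.
set y := 1 / 2 ^+ n.+1.
have yy : 1 / 2 ^+ n = y + y.
  by rewrite /y exprS; field; rewrite expf_neq0.
by move: IH; rewrite yy fD; lra.
Qed.

(** * The functional equation *)

Lemma sqnorm1 (R : realType) : sqnorm (1 : R[i]) = 1.
Proof. by rewrite /sqnorm/= expr0n expr1n addr0. Qed.

Lemma sqnorm_conj (R : realType) (z : R[i]) : sqnorm (conjc z) = sqnorm z.
Proof. by case: z => a b; rewrite /sqnorm/= sqrrN. Qed.

(* [q] is a quadratic form [t |-> k t^2]; comparing [v] with [- v] gives
   [4 k (a2 b2 + a3 b3) u v = 0]. *)
Lemma quadratic_log_modulus (R : realType) (a2 a3 b2 b3 : R) (q : R -> R) :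
  a2 * b2 != - (a3 * b3) -> continuous q -> (forall t, q (- t) = q t) -> q 0 = 0 ->
  (forall r s t, q (r + s + t) + q r + q s + q t = q (r + s) + q (s + t) + q (r + t)) ->
  (forall u v, q (a2 * u + b2 * v) + q (a3 * u + b3 * v) =
               q (a2 * u - b2 * v) + q (a3 * u - b3 * v)) ->
  forall t, q t = 0.
Proof.
move=> ab qc qN q0 q3 quv.
(* [B] is the polarization of [q]: the vanishing third difference makes it biadditive, and
   continuity makes it bilinear. *)
pose B s t := q (s + t) - q s - q t.
have BC s t : B s t = B t s by rewrite /B [t + s]addrC; ring.
have BD r s t : B (r + s) t = B r t + B s t.
  by rewrite /B; have := q3 r s t; lra.
have Bc t : continuous (B^~ t).
  move=> s; rewrite /B; apply: cvgB; last exact: cvg_cst.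
  apply: cvgB; last exact: qc.
  apply: (@continuous_comp _ _ _ (fun s => s + t) q); last exact: qc.
  by apply: cvgD; [exact: cvg_id|exact: cvg_cst].
have Blin s t : B s t = s * t * B 1 1.
  rewrite (@continuous_additive_linear _ (B^~ t)) // BC.
  by rewrite (@continuous_additive_linear _ (B^~ 1)) // mulrA.
have q2 s t : q (s + t) - q (s - t) = 2 * B s t.
  have : B s (- t) = - B s t by rewrite Blin (Blin s t); ring.
  by rewrite /B qN; lra.
(* At [u = v = 1] the symmetry says that [B a2 b2 + B a3 b3] vanishes. *)
have B11 : B 1 1 = 0.
  have := quv 1 1; rewrite !mulr1 => E.
  have := q2 a2 b2; have := q2 a3 b3; rewrite (Blin a2) (Blin a3) => E3 E2.
  have /eqP : (a2 * b2 + a3 * b3) * B 1 1 = 0 by lra.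
  by rewrite mulf_eq0 addr_eq0 (negbTE ab) => /eqP.
(* As [q] is even and [q 0 = 0], the value [B t (- t)] is [- 2 * q t]. *)
move=> t; have := Blin t (- t).
by rewrite B11 mulr0 /B subrr q0 qN; lra.
Qed.

(** The logarithm of the squared modulus turns the multiplicative third difference into an additive
    one. Conjugate symmetry makes the moduli of [H] and [h4] even. *)
Lemma noncollinear_unit (R : realType) (a2 a3 b2 b3 : R) (h1 H h4 : R -> R[i]) :
  a2 != 0 -> b2 != 0 -> a2 * b3 != a3 * b2 -> a2 * b2 != - (a3 * b3) ->
  ccontinuous H -> H 0 = 1 -> (forall t, H t != 0) ->
  (forall t, H (- t) = conjc (H t)) ->
  (forall t, h4 (- t) = conjc (h4 t)) ->
  (forall u v, h1 u * H (a2 * u + b2 * v) * H (a3 * u + b3 * v) * h4 v = 1) ->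
  forall t, sqnorm (H t) = 1.
Proof.
move=> a20 b20 D0 ab Hc H0 Hn0 HN h4N E t.
have H3 := third_difference a20 b20 D0 H0 E.
pose q t := ln (sqnorm (H t)).
have A0 s : 0 < sqnorm (H s) by apply: sqnorm_gt0.
suff q0 : q t = 0 by rewrite -(lnK (A0 t)) -/(q t) q0 expR0.
apply: (quadratic_log_modulus ab).
- move=> s; apply: (@continuous_comp _ _ _ (fun t => sqnorm (H t)) (@ln R)).
    exact: sqnorm_continuous.
  exact: continuous_ln.
- by move=> s; rewrite /q HN sqnorm_conj.
- by rewrite /q H0 sqnorm1 ln1.
- move=> r s u; rewrite /q -!lnM ?posrE ?mulr_gt0// -!sqnormM.
  by rewrite H3.
move=> u v.
rewrite /q -!lnM ?posrE ?mulr_gt0//; congr ln.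
(* Both equations share the factor [sqnorm (h1 u) * sqnorm (h4 v)], which cancels. *)
have E1 := congr1 (@sqnorm R) (E u v); have E2 := congr1 (@sqnorm R) (E u (- v)).
rewrite !sqnormM sqnorm1 in E1; rewrite !sqnormM h4N sqnorm_conj sqnorm1 !mulrN in E2.
have nz : sqnorm (h1 u) * sqnorm (h4 v) != 0.
  by apply/eqP => /eqP; rewrite mulf_eq0 => /orP[]/eqP z; move: E1;
    rewrite z ?mul0r ?mulr0 => /eqP; rewrite eq_sym oner_eq0.
apply: (mulfI nz); transitivity (1 : R); first by rewrite -E1; ring.
by rewrite -E2; ring.
Qed.

(** Once [H] is unimodular, [H (- t)] inverts [H t], and the third difference along [- s], [s], [t]
    becomes [H t ^+ 2 = H (t + s) * H (t - s)]. Multiplying this by its copy with [s] and [t]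
    exchanged shows that [H ^+ 2] is multiplicative. *)
Lemma noncollinear_cis (R : realType) (a2 a3 b2 b3 : R) (h1 H h4 : R -> R[i]) :
  a2 != 0 -> b2 != 0 -> a2 * b3 != a3 * b2 -> a2 * b2 != - (a3 * b3) ->
  ccontinuous H -> H 0 = 1 -> (forall t, H t != 0) ->
  (forall t, H (- t) = conjc (H t)) ->
  (forall t, h4 (- t) = conjc (h4 t)) ->
  (forall u v, h1 u * H (a2 * u + b2 * v) * H (a3 * u + b3 * v) * h4 v = 1) ->
  exists c, forall t, H t = cis c t.
Proof.
move=> a20 b20 D0 ab Hc H0 Hn0 HN h4N E.
have H1 := noncollinear_unit a20 b20 D0 ab Hc H0 Hn0 HN h4N E.
have H3 := third_difference a20 b20 D0 H0 E.
have HHN t : H t * H (- t) = 1.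
  by rewrite HN mulc_conj H1.
have H2 s t : H t ^+ 2 = H (t + s) * H (t - s).
  have := H3 (- s) s t; rewrite addNr add0r H0 mul1r [- s + t]addrC [s + t]addrC => <-.
  transitivity (H t ^+ 2 * (H s * H (- s))); last by ring.
  by rewrite HHN mulr1.
have [c Hcis] : exists c, forall t, H t ^+ 2 = cis c t.
  apply: unit_character_cis.
  - exact: ccontinuousM.
  - move=> s t; rewrite [H s ^+ 2](H2 t s) [H t ^+ 2](H2 s t) [t + s]addrC -[t - s]opprB.
    transitivity (H (s + t) ^+ 2 * (H (s - t) * H (- (s - t)))); last by ring.
    by rewrite HHN mulr1.
  - by move=> t; rewrite expr2 sqnormM H1 mulr1.
by exists (c / 2); exact: sqrt_cis.
Qed.

Lemma equal_coefficients_cis (R : realType) (a c : R) (H : R -> R[i]) :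
  a != 0 -> ccontinuous H -> H 0 = 1 ->
  (forall w, H (a * w) * H (a * w) = cis c w) -> exists c', forall t, H t = cis c' t.
Proof.
move=> a0 Hc H0 E; exists (c / a / 2); apply: sqrt_cis => // t.
have := E (t / a); rewrite mulrCA divff// mulr1 expr2 => ->.
by rewrite [t / a]mulrC cisMx.
Qed.

(** The relation at [w] and at [r * w] gives [m (r ^+ 2 * w) = m w]; iterating moves the argument to
    0, where continuity gives the value. *)
Lemma reciprocal_contraction (R : realType) (m : R -> R[i]) (r : R) :
  ccontinuous m -> m 0 = 1 -> `|r| < 1 -> (forall w, m w * m (r * w) = 1) ->
  forall t, m t = 1.
Proof.
move=> [m1 m2] m0 r1 E t.
have mr w : m (r ^+ 2 * w) = m w.
  have nz : m (r * w) != 0.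
    by apply/eqP => z; have := E w; rewrite z mulr0 => /eqP; rewrite eq_sym oner_eq0.
  by apply: (mulfI nz); rewrite [RHS]mulrC E expr2 -mulrA E.
have mn n : m ((r ^+ 2) ^+ n * t) = m t.
  by elim: n => [|n IH]; rewrite ?expr0 ?mul1r// exprS -mulrA mr.
have cvg0 : (r ^+ 2) ^+ n * t @[n --> \oo] --> (0 : R).
  rewrite -[X in _ --> X](mul0r t); apply: cvgM; last exact: cvg_cst.
  by apply: cvg_expr; rewrite normrX expr_lt1.
have aux (f : R -> R) : continuous f -> (forall n, f ((r ^+ 2) ^+ n * t) = f t) -> f t = f 0.
  move=> fc fn; have : f ((r ^+ 2) ^+ n * t) @[n --> \oo] --> f 0.
    exact: (cvg_comp _ _ cvg0 (fc 0)).
  under eq_fun do rewrite fn.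
  by move=> /(cvg_unique _ (cvg_cst (f t))); apply.
apply/eqP; rewrite eq_complex -m0; apply/andP; split; apply/eqP.
  by apply: (aux (fun s => complex.Re (m s))) => // n; rewrite mn.
by apply: (aux (fun s => complex.Im (m s))) => // n; rewrite mn.
Qed.

Lemma reciprocal_scaling (R : realType) (a2 a3 : R) (m : R -> R[i]) :
  a2 != 0 -> a3 != 0 -> `|a2| != `|a3| ->
  ccontinuous m -> m 0 = 1 -> (forall w, m (a2 * w) * m (a3 * w) = 1) ->
  forall t, m t = 1.
Proof.
wlog lt_a : a2 a3 / `|a3| < `|a2|.
  move=> wl a20 a30 aa mc m0 E; have := aa; rewrite neq_lt => /orP[lt|lt].
    by apply: (wl a3 a2) => //; [rewrite eq_sym|move=> w; rewrite mulrC].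
  exact: (wl a2 a3).
move=> a20 a30 _ mc m0 E; apply: (@reciprocal_contraction _ _ (a3 / a2)) => //.
  by rewrite normrM normfV ltr_pdivrMr ?mul1r// normr_gt0.
by move=> w; have := E (w / a2); rewrite mulrCA divff// mulr1 mulrA mulrAC.
Qed.

Lemma functional_equation_cis (R : realType) (a2 a3 b2 b3 : R) (h1 H h4 : R -> R[i]) :
  a2 != 0 -> a3 != 0 -> b2 != 0 ->
  [\/ (a2 * b3 != a3 * b2) && (a2 * b2 != - (a3 * b3)),
      (a2 * b3 == a3 * b2) && (`|a2| != `|a3|)
    | (a2 * b3 == a3 * b2) && (a2 == a3)] ->
  ccontinuous H -> H 0 = 1 -> (forall t, H t != 0) ->
  (forall t, H (- t) = conjc (H t)) ->
  (forall t, h4 (- t) = conjc (h4 t)) ->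
  (forall u v, h1 u * H (a2 * u + b2 * v) * H (a3 * u + b3 * v) * h4 v = 1) ->
  exists c, forall t, H t = cis c t.
Proof.
move=> a20 a30 b20 cond Hc H0 Hn0 HN h4N E.
have collinear : a2 * b3 == a3 * b2 -> exists c, forall w, H (a2 * w) * H (a3 * w) = cis c w.
  (* Proportionality makes both arguments multiples, by [a2] and [a3], of the same
     [u + b2 / a2 * v]. *)
  move=> /eqP ab; pose K w := H (a2 * w) * H (a3 * w).
  have K0 : K 0 = 1 by rewrite /K !mulr0 H0 mulr1.
  have KD s t : K (s + t) = K s * K t.
    apply: (@collinear_character _ _ h1 K h4 (b2 / a2)) => //.
      by rewrite mulf_neq0// invr_neq0.
    move=> u v; rewrite -(E u v) /K -!mulrA; congr (_ * (H _ * (H _ * _))); first by field.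
    by rewrite mulrDr; congr (_ + _); rewrite !mulrA -ab; field.
  apply: unit_character_cis => //.
    by apply: ccontinuousM; exact: ccontinuous_scale.
  (* The conjugate of [K t] is [K (- t)], so the product is [K 0]. *)
  move=> t; have : K t * conjc (K t) = 1.
    rewrite -K0 -(subrr t) KD; congr (_ * _).
    by rewrite /K !mulrN !HN; exact: rmorphM.
  by rewrite mulc_conj => -[].
case: cond => [/andP[D0 ab]|/andP[/collinear[c Ec] aa]|/andP[/collinear[c Ec] /eqP aa]].
- exact: (@noncollinear_cis _ a2 a3 b2 b3 h1 H h4).
- have a23 : a2 + a3 != 0.
    by apply: contra aa; rewrite addr_eq0 => /eqP ->; rewrite normrN.
  (* This is the frequency whose character also satisfies the equation with right-hand side
     [cis c w]; dividing by it makes that side 1. *)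
  pose k := c / (a2 + a3); exists k.
  have m1 : forall t, H t * cis (- k) t = 1.
    apply: (@reciprocal_scaling _ a2 a3) => //.
    + by apply: ccontinuousM => //; exact: ccontinuous_cis.
    + by rewrite H0 cis0 mulr1.
    move=> w; rewrite mulrACA Ec -cisD -mulrDl cisMx.
    have -> : - k * (a2 + a3) = - c by rewrite /k; field.
    exact: cisN.
  by move=> t; rewrite -[RHS]mul1r -(m1 t) -mulrA [X in _ * X]mulrC cisN mulr1.
- by apply: (@equal_coefficients_cis _ a2 c) => // w; rewrite {2}aa.
Qed.

(** * Independence and characteristic functions *)

(** Rectangles are stable under intersection, generate the product sigma-algebra and include the
    whole space, of finite mass. *)
Lemma rectangles_measure_unique d1 d2 (V1 : measurableType d1) (V2 : measurableType d2)
    (R : realType) (m1 m2 : {measure set (V1 * V2) -> \bar R}) :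
  (m1 setT < +oo)%E ->
  (forall A B, measurable A -> measurable B -> m1 (A `*` B) = m2 (A `*` B)) ->
  forall C, measurable C -> m1 C = m2 C.
Proof.
move=> m1oo m12; apply: (@measure_unique _ _ _
  [set A1 `*` A2 | A1 in measurable & A2 in measurable] (fun=> setT)).
- exact: measurable_prod_measurableType.
- move=> X Y [X1 mX1 [X2 mX2 <-{X}]] [Y1 mY1 [Y2 mY2 <-{Y}]].
  exists (X1 `&` Y1); first exact: measurableI.
  by exists (X2 `&` Y2); [exact: measurableI|rewrite setXI].
- by move=> _; exists setT => //; exists setT => //; rewrite setXTT.
- by rewrite bigcup_const.
- by move=> _ [A1 mA1 [A2 mA2 <-]]; exact: m12.
- by move=> _.
Qed.

(** As functions of [C], both sides are finite measures: the image of [P] restricted to [E], and the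
    law of the pair scaled by [P E]. They agree on rectangles. *)
Lemma indep_pair_event d (T : measurableType d) (R : realType) (P : probability T R)
    d1 d2 (V1 : measurableType d1) (V2 : measurableType d2)
    (X : {mfun T >-> V1}) (Y : {mfun T >-> V2}) (E : set T) :
  measurable E ->
  (forall A B, measurable A -> measurable B ->
    P (X @^-1` A `&` Y @^-1` B `&` E) = (P (X @^-1` A `&` Y @^-1` B) * P E)%E) ->
  forall C, measurable C ->
    P ((fun x => (X x, Y x)) @^-1` C `&` E) = (P ((fun x => (X x, Y x)) @^-1` C) * P E)%E.
Proof.
move=> mE ind C mC.
have mXY : measurable_fun setT (fun x => (X x, Y x)) by exact: measurable_fun_pair.
pose XY : {mfun T >-> (V1 * V2)%type} :=
  HB.pack (fun x => (X x, Y x)) (isMeasurableFun.Build _ _ _ _ _ mXY).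
have PE : P E \is a fin_num by exact: fin_num_measure.
pose r : {nonneg R} := NngNum (fine_ge0 (measure_ge0 P E)).
transitivity (mscale r (distribution P XY) C); last by rewrite /mscale/= fineK// muleC.
apply: (@rectangles_measure_unique _ _ _ _ _
  (pushforward (mrestr P mE) XY) (mscale r (distribution P XY))) => //.
  by change (P (XY @^-1` setT `&` E) < +oo)%E; rewrite preimage_setT setTI ltey_eq fin_num_measure.
move=> A B mA mB.
change (P (XY @^-1` (A `*` B) `&` E) = (fine (P E))%:E * P (XY @^-1` (A `*` B)))%E.
by rewrite fineK// muleC; exact: ind.
Qed.

Lemma probability_bounded_integrable d (T : measurableType d) (R : realType)
    (P : probability T R) (f : T -> R) (M : R) :
  measurable_fun setT f -> (forall x, `|f x| <= M) -> P.-integrable setT (EFin \o f).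
Proof.
move=> mf fM; apply: measurable_bounded_integrable => //.
  by rewrite ltey_eq fin_num_measure.
by exists M; split; [exact: num_real|move=> x Mx y _; exact: le_trans (fM y) (ltW Mx)].
Qed.

Lemma bounded_integral_distribution d dV (T : measurableType d) (V : measurableType dV)
    (R : realType) (P : probability T R) (X : {mfun T >-> V}) (f : V -> R) (M : R) :
  measurable_fun setT f -> (forall v, `|f v| <= M) ->
  (\int[P]_x (f (X x))%:E = \int[distribution P X]_v (f v)%:E)%E.
Proof.
move=> mf fM; have mf' : measurable_fun setT (EFin \o f) by exact/measurable_EFinP.
have ifX : P.-integrable (X @^-1` setT) ((EFin \o f) \o X).
  rewrite preimage_setT.
  by apply: (@probability_bounded_integrable _ _ _ P (f \o X) M);
    [exact: measurableT_comp|move=> x; exact: fM].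
have := integral_pushforward (measurable_funPT X) mf' ifX measurableT.
by rewrite preimage_setT.
Qed.

Lemma same_law_Rintegral d d' dV (T : measurableType d) (T' : measurableType d')
    (V : measurableType dV) (R : realType) (P : probability T R) (Q : probability T' R)
    (X : {mfun T >-> V}) (Y : {mfun T' >-> V}) (f : V -> R) (M : R) :
  same_law P Q X Y -> measurable_fun setT f -> (forall v, `|f v| <= M) ->
  \int[P]_x f (X x) = \int[Q]_y f (Y y).
Proof.
move=> XY mf fM; rewrite /Rintegral; congr fine.
rewrite !(bounded_integral_distribution _ _ mf fM).
by apply: eq_measure_integral => A mA _; exact: XY.
Qed.

(** Independence identifies the joint law with the product of the marginals ([E1]), and Fubini's
    theorem separates the factors ([E2]). *)
Lemma indep_Rintegral_mul d (T : measurableType d) (R : realType) (P : probability T R)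
    d1 d2 (V1 : measurableType d1) (V2 : measurableType d2)
    (X : {mfun T >-> V1}) (Y : {mfun T >-> V2}) (f : V1 -> R) (g : V2 -> R) (M N : R) :
  (forall A B, measurable A -> measurable B ->
    P (X @^-1` A `&` Y @^-1` B) = (P (X @^-1` A) * P (Y @^-1` B))%E) ->
  measurable_fun setT f -> (forall v, `|f v| <= M) ->
  measurable_fun setT g -> (forall v, `|g v| <= N) ->
  \int[P]_x (f (X x) * g (Y x)) = (\int[P]_x f (X x)) * (\int[P]_x g (Y x)).
Proof.
move=> ind mf fM mg gN.
have mXY : measurable_fun setT (fun x => (X x, Y x)) by exact: measurable_fun_pair.
pose XY : {mfun T >-> (V1 * V2)%type} :=
  HB.pack (fun x => (X x, Y x)) (isMeasurableFun.Build _ _ _ _ _ mXY).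
pose fg z := f z.1 * g z.2.
have mfg : measurable_fun setT fg.
  by apply: measurable_funM; apply: measurableT_comp.
have fgM z : `|fg z| <= M * N by rewrite normrM ler_pM.
pose m1 := distribution P X; pose m2 := distribution P Y.
have ifX := @probability_bounded_integrable _ _ _ m1 f M mf fM.
have ifY := @probability_bounded_integrable _ _ _ m2 g N mg gN.
have E1 : (\int[P]_x (fg (XY x))%:E = \int[m1 \x m2]_z (fg z)%:E)%E.
  rewrite (bounded_integral_distribution P XY mfg fgM).
  apply: eq_measure_integral => A mA _; apply/esym; apply: product_measure_unique => //.
have ifg : (m1 \x m2)%E.-integrable setT (EFin \o fg).
  exact: (@probability_bounded_integrable _ _ _ (m1 \x m2)%E fg (M * N)).
have E2 := integral12_prod_meas1 ifg.
have iX : \int[P]_x f (X x) = \int[m1]_x f x.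
  by congr fine; exact: bounded_integral_distribution fM.
have iY : \int[P]_x g (Y x) = \int[m2]_x g x.
  by congr fine; exact: bounded_integral_distribution gN.
rewrite iX iY -RintegralZr// /Rintegral; congr fine; rewrite [LHS]E1 -E2.
apply: eq_integral => x _; rewrite /fubini_F /= /fg/=.
under eq_integral do rewrite EFinM.
rewrite integralZl// EFinM; congr (_ * _)%E.
by rewrite fineK//; exact: integrable_fin_num.
Qed.

Lemma measurable_cos_scale (R : realType) (t : R) : measurable_fun setT (fun x : R => cos (t * x)).
Proof.
apply: continuous_measurable_fun => x.
by apply: continuous_comp; [exact: mulrl_continuous|exact: continuous_cos].
Qed.

Lemma measurable_sin_scale (R : realType) (t : R) : measurable_fun setT (fun x : R => sin (t * x)).
Proof.
apply: continuous_measurable_fun => x.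
by apply: continuous_comp; [exact: mulrl_continuous|exact: continuous_sin].
Qed.

Lemma integrable_cos d (T : measurableType d) (R : realType) (P : probability T R)
    (X : {mfun T >-> R}) (t : R) : P.-integrable setT (EFin \o (fun x => cos (t * X x))).
Proof.
apply: (@probability_bounded_integrable _ _ _ _ _ 1); last by move=> x; exact: cos_max.
exact: (measurableT_comp (measurable_cos_scale t)).
Qed.

Lemma integrable_sin d (T : measurableType d) (R : realType) (P : probability T R)
    (X : {mfun T >-> R}) (t : R) : P.-integrable setT (EFin \o (fun x => sin (t * X x))).
Proof.
apply: (@probability_bounded_integrable _ _ _ _ _ 1); last by move=> x; exact: sin_max.
exact: (measurableT_comp (measurable_sin_scale t)).
Qed.

Lemma charfun0 d (T : measurableType d) (R : realType) (P : probability T R) (X : T -> R) :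
  charfun P X 0 = 1.
Proof.
rewrite /charfun; under eq_Rintegral do rewrite mul0r cos0.
under [X in (_ +i* X)%C]eq_Rintegral do rewrite mul0r sin0.
rewrite !Rintegral_cst// mul0r; congr (_ +i* _)%C.
by rewrite mul1r [X in fine X]probability_setT.
Qed.

Lemma charfunN d (T : measurableType d) (R : realType) (P : probability T R)
    (X : {mfun T >-> R}) (t : R) : charfun P X (- t) = conjc (charfun P X t).
Proof.
rewrite /charfun /=; congr (_ +i* _)%C.
  by under eq_Rintegral do rewrite mulNr cosN.
rewrite -mulN1r -RintegralZl//; last exact: integrable_sin.
by under eq_Rintegral do rewrite mulNr sinN -mulN1r.
Qed.

(** Continuity under the integral sign on the interval of radius 1 around [t], with the constant 1
    as dominating function. *)
Lemma ccontinuous_charfun d (T : measurableType d) (R : realType) (P : probability T R)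
    (X : {mfun T >-> R}) : ccontinuous (charfun P X).
Proof.
have int1 : P.-integrable setT (EFin \o (cst 1 : T -> R)).
  by apply: (@probability_bounded_integrable _ _ _ _ _ 1) => // x; rewrite normr1.
have mem (t : R) : t \in `]t - 1, t + 1[%classic.
  by rewrite inE/= in_itv/= ltrBlDr ltrDl ltr01.
split => t /=.
  apply: (@continuity_under_integral _ _ _ P (fun s x => cos (s * X x)) setT measurableT
    (t - 1) (t + 1) _ _ (cst 1) int1 _ t (mem t)).
  - by move=> s _; exact: integrable_cos.
  - apply: aeW => x _ s _; apply: continuous_comp; [exact: mulrr_continuous|exact: continuous_cos].
  - by move=> s _; apply: aeW => x _; exact: cos_max.
apply: (@continuity_under_integral _ _ _ P (fun s x => sin (s * X x)) setT measurableT
  (t - 1) (t + 1) _ _ (cst 1) int1 _ t (mem t)).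
- by move=> s _; exact: integrable_sin.
- apply: aeW => x _ s _; apply: continuous_comp; [exact: mulrr_continuous|exact: continuous_sin].
- by move=> s _; apply: aeW => x _; exact: sin_max.
Qed.

Lemma same_law_charfun d d' (T : measurableType d) (T' : measurableType d')
    (R : realType) (P : probability T R) (Q : probability T' R)
    (X : {mfun T >-> R}) (Y : {mfun T' >-> R}) (t : R) :
  same_law P Q X Y -> charfun P X t = charfun Q Y t.
Proof.
move=> XY; rewrite /charfun; congr (_ +i* _)%C.
  apply: (same_law_Rintegral XY (measurable_cos_scale t)) => x; exact: cos_max.
apply: (same_law_Rintegral XY (measurable_sin_scale t)) => x; exact: sin_max.
Qed.

Lemma charfun_shift d (T : measurableType d) (R : realType) (P : probability T R)
    (X : {mfun T >-> R}) (c t : R) :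
  charfun P (fun x => X x + c) t = charfun P X t * cis c t.
Proof.
rewrite /charfun /cis; simpc; congr (_ +i* _)%C.
  under eq_Rintegral do rewrite mulrDr cosD [t * c]mulrC.
  rewrite RintegralB// ?RintegralZr//; try exact: integrable_cos; try exact: integrable_sin.
    by have := @integrableZr _ _ _ P setT measurableT (cos (c * t)) _ (integrable_cos P X t).
  by have := @integrableZr _ _ _ P setT measurableT (sin (c * t)) _ (integrable_sin P X t).
under eq_Rintegral do rewrite mulrDr sinD [t * c]mulrC.
rewrite RintegralD// ?RintegralZr//; try exact: integrable_cos; try exact: integrable_sin.
- by rewrite addrC.
- by have := @integrableZr _ _ _ P setT measurableT (cos (c * t)) _ (integrable_sin P X t).
- by have := @integrableZr _ _ _ P setT measurableT (sin (c * t)) _ (integrable_cos P X t).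
Qed.

Lemma measurable_lin2 d (T : measurableType d) (R : realType) (X Y : {mfun T >-> R}) (s t : R) :
  measurable_fun setT (fun x => s * X x + t * Y x).
Proof. by apply: measurable_funD; apply: measurable_funM. Qed.

(** Bundled with its measurability so that combinations can be nested, adding one variable at a
    time. *)
Definition lin2 d (T : measurableType d) (R : realType) (s t : R) (X Y : {mfun T >-> R}) :
  {mfun T >-> R} :=
  HB.pack (fun x => s * X x + t * Y x)
    (isMeasurableFun.Build _ _ _ _ _ (measurable_lin2 X Y s t)).

Lemma charfun_lin2 d (T : measurableType d) (R : realType) (P : probability T R)
    (X Y : {mfun T >-> R}) (s t r : R) :
  (forall A B, measurable A -> measurable B ->
    P (X @^-1` A `&` Y @^-1` B) = (P (X @^-1` A) * P (Y @^-1` B))%E) ->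
  charfun P (lin2 s t X Y) r = charfun P X (r * s) * charfun P Y (r * t).
Proof.
move=> ind.
have mc a : measurable_fun setT (fun x : R => cos (a * x)) := measurable_cos_scale a.
have ms a : measurable_fun setT (fun x : R => sin (a * x)) := measurable_sin_scale a.
have nc a (x : R) : `|cos (a * x)| <= 1 := cos_max _.
have ns a (x : R) : `|sin (a * x)| <= 1 := sin_max _.
have int (f g : R -> R) : measurable_fun setT f -> measurable_fun setT g ->
    (forall x, `|f x| <= 1) -> (forall x, `|g x| <= 1) ->
    P.-integrable setT (EFin \o (fun x => f (X x) * g (Y x))).
  move=> mf mg f1 g1; apply: (@probability_bounded_integrable _ _ _ _ _ 1).
    by apply: measurable_funM; apply: measurableT_comp.
  by move=> x; rewrite normrM mulr_ile1.
rewrite /charfun; simpc; congr (_ +i* _)%C.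
  under eq_Rintegral do rewrite /= mulrDr !mulrA cosD.
  rewrite RintegralB//; [|exact: (int (fun x => cos (r * s * x)) (fun x => cos (r * t * x)))
    |exact: (int (fun x => sin (r * s * x)) (fun x => sin (r * t * x)))].
  by rewrite (indep_Rintegral_mul ind (mc (r * s)) (nc (r * s)) (mc (r * t)) (nc (r * t)))
    (indep_Rintegral_mul ind (ms (r * s)) (ns (r * s)) (ms (r * t)) (ns (r * t))).
under eq_Rintegral do rewrite /= mulrDr !mulrA sinD.
rewrite RintegralD//; [|exact: (int (fun x => sin (r * s * x)) (fun x => cos (r * t * x)))
  |exact: (int (fun x => cos (r * s * x)) (fun x => sin (r * t * x)))].
by rewrite addrC (indep_Rintegral_mul ind (mc (r * s)) (nc (r * s)) (ms (r * t)) (ns (r * t)))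
  (indep_Rintegral_mul ind (ms (r * s)) (ns (r * s)) (mc (r * t)) (nc (r * t))).
Qed.

Lemma indep_lin2 d (T : measurableType d) (R : realType) (P : probability T R)
    (X Y : {mfun T >-> R}) (E : set T) (s t : R) :
  measurable E ->
  (forall A B, measurable A -> measurable B ->
    P (X @^-1` A `&` Y @^-1` B `&` E) = (P (X @^-1` A `&` Y @^-1` B) * P E)%E) ->
  forall A, measurable A ->
    P (lin2 s t X Y @^-1` A `&` E) = (P (lin2 s t X Y @^-1` A) * P E)%E.
Proof.
move=> mE ind A mA.
have mC : measurable ((fun z : R * R => s * z.1 + t * z.2) @^-1` A).
  rewrite -[X in measurable X]setTI.
  have mst : measurable_fun setT (fun z : R * R => s * z.1 + t * z.2).
    by apply: measurable_funD; apply: measurable_funM.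
  exact: mst.
exact: (indep_pair_event mE ind mC).
Qed.

(** The frequencies are absorbed into the coefficients, hence the evaluation at 1. Each partial sum
    is independent of the next variable, so factors split off one by one. *)
Lemma mutually_indep4_charfun d (T : measurableType d) (R : realType) (P : probability T R)
    (X1 X2 X3 X4 : {mfun T >-> R}) (s1 s2 s3 s4 : R) :
  mutually_indep4 P X1 X2 X3 X4 ->
  charfun P (lin2 1 s4 (lin2 1 s3 (lin2 s1 s2 X1 X2) X3) X4) 1 =
  charfun P X1 s1 * charfun P X2 s2 * charfun P X3 s3 * charfun P X4 s4.
Proof.
move=> ind.
have mX (X : {mfun T >-> R}) (A : set R) : measurable A -> measurable (X @^-1` A).
  by move=> mA; rewrite -[X in measurable X]setTI; exact: measurable_funPT.
have P1 := @probability_setT _ _ _ P.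
have ind12 A B : measurable A -> measurable B ->
    P (X1 @^-1` A `&` X2 @^-1` B) = (P (X1 @^-1` A) * P (X2 @^-1` B))%E.
  move=> mA mB; have := ind A B setT setT mA mB measurableT measurableT.
  by rewrite !preimage_setT !setIT P1 !mule1.
have ind34 A B : measurable A -> measurable B ->
    P (X3 @^-1` A `&` X4 @^-1` B) = (P (X3 @^-1` A) * P (X4 @^-1` B))%E.
  move=> mA mB; have := ind setT setT A B measurableT measurableT mA mB.
  by rewrite !preimage_setT !setTI P1 !mul1e.
pose Y := lin2 s1 s2 X1 X2.
(* The event on [X3] and [X4] plays the role of [E] in [indep_lin2]. *)
have indY A B C : measurable A -> measurable B -> measurable C ->
    P (Y @^-1` A `&` X3 @^-1` B `&` X4 @^-1` C) =
    (P (Y @^-1` A) * P (X3 @^-1` B) * P (X4 @^-1` C))%E.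
  move=> mA mB mC; rewrite -setIA -muleA -ind34//.
  apply: indep_lin2 => //; first by apply: measurableI; exact: mX.
  by move=> A' B' mA' mB'; rewrite setIA ind// ind12// ind34// !muleA.
have indY3 A B : measurable A -> measurable B ->
    P (Y @^-1` A `&` X3 @^-1` B) = (P (Y @^-1` A) * P (X3 @^-1` B))%E.
  move=> mA mB; have := indY A B setT mA mB measurableT.
  by rewrite !preimage_setT !setIT P1 !mule1.
rewrite !charfun_lin2 ?mul1r ?mulr1//.
move=> A B mA mB; apply: indep_lin2 => //; first exact: mX.
by move=> A' B' mA' mB'; rewrite indY// indY3.
Qed.

(** * Uniqueness theorem for characteristic functions *)

Lemma bernoulli_inequality (R : realDomainType) (x : R) (n : nat) :
  -1 <= x -> 1 + n%:R * x <= (1 + x) ^+ n.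
Proof.
move=> x1; elim: n => [|n IH]; first by rewrite mul0r addr0 expr0.
rewrite exprS; have x1' : 0 <= 1 + x by rewrite -lerBlDl sub0r.
apply: le_trans (ler_wpM2l x1' IH).
have -> : (1 + x) * (1 + n%:R * x) = 1 + n.+1%:R * x + n%:R * x ^+ 2.
  by rewrite -natr1; ring.
by rewrite lerDl mulr_ge0// sqr_ge0.
Qed.

(** For [z = w * w] with [0 < w < 1], Bernoulli's inequality for [w^-1 = 1 + h] bounds
    [n%:R * w ^+ n] by [h^-1]; the other factor [w ^+ n] tends to 0. *)
Lemma cvg_natM_expr (R : realType) (z : R) :
  0 <= z < 1 -> n%:R * z ^+ n @[n --> \oo] --> (0 : R).
Proof.
move=> /andP[z0 z1].
have [->|zN0] := eqVneq z 0.
  by apply: cvg_near_cst; exists 1%N => // n /= n0; rewrite expr0n gtn_eqF// mulr0.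
have zgt0 : 0 < z by rewrite lt_neqAle eq_sym zN0.
pose w := Num.sqrt z; have w0 : 0 < w by rewrite sqrtr_gt0.
have w2 : w * w = z by rewrite -expr2 sqr_sqrtr.
have w1 : w < 1 by rewrite -sqrtr1 ltr_sqrt.
pose h := w^-1 - 1; have h0 : 0 < h by rewrite subr_gt0 invf_gt1.
have nw n : n%:R * w ^+ n <= h^-1.
  rewrite -[leRHS]mul1r ler_pdivlMr// mulrAC -ler_pdivlMr ?exprn_gt0// mul1r -exprVn.
  have -> : w^-1 = 1 + h by rewrite /h addrC subrK.
  apply: le_trans (bernoulli_inequality _ _); first by rewrite lerDr.
  by apply: le_trans (ltW h0); rewrite lerN10.
apply: (@squeeze_cvgr _ _ _ _ (cst 0) (fun n => h^-1 * w ^+ n)).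
- near=> n; rewrite mulr_ge0 ?exprn_ge0//=.
  by rewrite -w2 exprMn mulrA ler_wpM2r// exprn_ge0// ltW.
- exact: cvg_cst.
- rewrite -[X in _ --> X](mulr0 h^-1); apply: cvgM; first exact: cvg_cst.
  by apply: cvg_expr; rewrite gtr0_norm.
Unshelve. all: by end_near.
Qed.

(* With [y = (1 - u) / 2] this is [(1 - y ^ n) ^ (n 2^n)]: Bernoulli's inequality bounds it below by
   [1 - n (2y)^n] when [y < 1/2] and above by [2^-n] when [1/2 <= y], boundary included. *)
Definition step_poly (R : realType) (n : nat) : {poly R} :=
  (1 - ((1 - 'X) * (2^-1)%:P) ^+ n) ^+ (2 ^ n * n).

Lemma horner_step_poly (R : realType) (n : nat) (u : R) :
  (step_poly R n).[u] = (1 - ((1 - u) / 2) ^+ n) ^+ (2 ^ n * n).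
Proof. by rewrite /step_poly !hornerE. Qed.

Lemma step_poly_ge0_le1 (R : realType) (n : nat) (u : R) :
  `|u| <= 1 -> 0 <= (step_poly R n).[u] <= 1.
Proof.
rewrite ler_norml horner_step_poly => /andP[u1 u2].
have y0 : 0 <= (1 - u) / 2 by lra.
have y1 : (1 - u) / 2 <= 1 by lra.
have w0 : 0 <= ((1 - u) / 2) ^+ n by rewrite exprn_ge0.
have w1 : ((1 - u) / 2) ^+ n <= 1 by rewrite exprn_ile1.
by rewrite exprn_ge0 ?subr_ge0// exprn_ile1 ?subr_ge0// gerBl.
Qed.

Lemma cvg_step_poly (R : realType) (u : R) :
  `|u| <= 1 -> (step_poly R n).[u] @[n --> \oo] --> ((0 < u)%R%:R : R).
Proof.
move=> u1; have p01 n := step_poly_ge0_le1 n u1.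
move: u1; rewrite ler_norml => /andP[u1 u2].
pose y := (1 - u) / 2.
have y0 : 0 <= y by rewrite /y; lra.
have y1 : y <= 1 by rewrite /y; lra.
have [u0|u0] := ltP 0 u.
  apply: (@squeeze_cvgr _ _ _ _ (fun n => 1 - n%:R * (2 * y) ^+ n) (cst 1)).
  - near=> n; have /andP[_ ->] := p01 n; rewrite andbT horner_step_poly -/y.
    have w1 : -1 <= - y ^+ n by rewrite lerN2 exprn_ile1.
    apply: le_trans (bernoulli_inequality _ w1).
    by rewrite natrM natrX mulrN exprMn; lra.
  - rewrite -[X in _ --> X](subr0 1); apply: cvgB; first exact: cvg_cst.
    by apply: cvg_natM_expr; rewrite /y; lra.
  - exact: cvg_cst.
apply: (@squeeze_cvgr _ _ _ _ (cst 0) (fun n => 2^-1 ^+ n)).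
- near=> n; have /andP[-> _] := p01 n; rewrite /= horner_step_poly -/y exprM.
  have yn0 : 0 <= y ^+ n by rewrite exprn_ge0.
  have yn1 : y ^+ n <= 1 by rewrite exprn_ile1.
  rewrite lerXn2r// ?nnegrE ?exprn_ge0 ?subr_ge0//.
  rewrite -[leRHS]mul1r ler_pdivlMr//.
  (* By Bernoulli the second factor is at least [1 + (2 * y) ^+ n], hence at least 2, since
     [1/2 <= y]. So the first is at most [2^-1], and the outer exponent [n] gives [2^-1 ^+ n]. *)
  have : (1 - y ^+ n) ^+ (2 ^ n) * (1 + y ^+ n) ^+ (2 ^ n) <= 1.
    rewrite -exprMn.
    have -> : (1 - y ^+ n) * (1 + y ^+ n) = 1 - (y ^+ n) ^+ 2 by ring.
    by rewrite exprn_ile1 ?gerBl ?sqr_ge0// subr_ge0 exprn_ile1.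
  apply: le_trans; apply: ler_wpM2l; first by rewrite exprn_ge0 ?subr_ge0.
  have yn1' : -1 <= y ^+ n by apply: le_trans yn0; rewrite lerN10.
  apply: le_trans (bernoulli_inequality _ yn1').
  rewrite natrX -exprMn -[2]/(1 + 1) lerD2l exprn_ege1//.
  by rewrite /y; lra.
- exact: cvg_cst.
- by apply: cvg_expr; rewrite ger0_norm; lra.
Unshelve. all: by end_near.
Qed.

Lemma cvg_bounded_Rintegral d (T : measurableType d) (R : realType) (P : probability T R)
    (f_ : nat -> T -> R) (f : T -> R) :
  (forall n, measurable_fun setT (f_ n)) -> (forall n x, `|f_ n x| <= 1) ->
  (forall x, f_ n x @[n --> \oo] --> f x) ->
  \int[P]_x f_ n x @[n --> \oo] --> \int[P]_x f x.
Proof.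
move=> mf f1 ff; have mflim : measurable_fun setT f.
  by apply: (measurable_fun_cvg mf) => x _; exact: ff.
have int1 : P.-integrable setT (EFin \o (cst 1 : T -> R)).
  by apply: (@probability_bounded_integrable _ _ _ _ _ 1) => // x; rewrite normr1.
have [] := @dominated_convergence _ _ _ P setT measurableT (fun n => EFin \o f_ n)
  (EFin \o f) (EFin \o cst 1) _ _ _ int1 _.
- by move=> n; exact/measurable_EFinP.
- exact/measurable_EFinP.
- by apply: aeW => x _; apply: cvg_EFin; [exact: nearW|exact: ff].
- by apply: aeW => x n _; rewrite lee_fin.
move=> intf _ cvgf; apply: fine_cvg.
by rewrite /Rintegral fineK//; exact: integrable_fin_num.
Qed.

(** Dominated convergence on both sides. It serves twice: from polynomials in a sine to the
    indicator of its positivity, then to the indicator of a ray. *)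
Lemma bounded_limit_Rintegral_eq d d' (T : measurableType d) (T' : measurableType d')
    (R : realType) (P : probability T R) (Q : probability T' R)
    (X : {mfun T >-> R}) (Y : {mfun T' >-> R}) (F_ : nat -> R -> R) (F : R -> R) :
  (forall n, measurable_fun setT (F_ n)) -> (forall n x, `|F_ n x| <= 1) ->
  (forall x, F_ n x @[n --> \oo] --> F x) ->
  (forall n, \int[P]_x F_ n (X x) = \int[Q]_y F_ n (Y y)) ->
  \int[P]_x F (X x) = \int[Q]_y F (Y y).
Proof.
move=> mF F1 FF PQ.
have c1 : \int[P]_x F_ n (X x) @[n --> \oo] --> \int[P]_x F (X x).
  apply: (@cvg_bounded_Rintegral _ _ _ P (fun n => F_ n \o X)) => [n|n x|x].
  - exact: measurableT_comp.
  - exact: F1.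
  - exact: FF.
have c2 : \int[Q]_x F_ n (Y x) @[n --> \oo] --> \int[Q]_x F (Y x).
  apply: (@cvg_bounded_Rintegral _ _ _ Q (fun n => F_ n \o Y)) => [n|n x|x].
  - exact: measurableT_comp.
  - exact: F1.
  - exact: FF.
have E : (fun n => \int[P]_x F_ n (X x)) = (fun n => \int[Q]_y F_ n (Y y)).
  exact/funext.
rewrite E in c1; exact: (cvg_unique _ c1 c2).
Qed.

Lemma horner_bounded_unit (R : realType) (p : {poly R}) :
  exists M, forall u, `|u| <= 1 -> `|p.[u]| <= M.
Proof.
elim/poly_ind: p => [|p c [M pM]]; first by exists 0 => u _; rewrite horner0 normr0.
exists (M + `|c|) => u u1; rewrite hornerMXaddC; apply: le_trans (ler_normD _ _) _.
rewrite lerD2r normrM; apply: le_trans (pM u u1).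
by rewrite ler_piMr.
Qed.

Lemma continuous_horner_sin (R : realType) (p : {poly R}) (s c : R) :
  continuous (fun x => p.[sin (s * x + c)]).
Proof.
move=> x; apply: continuous_comp; last exact: continuous_horner.
apply: continuous_comp; last exact: continuous_sin.
by apply: cvgD; [exact: mulrl_continuous|exact: cvg_cst].
Qed.

Lemma measurable_horner_sin_cos (R : realType) (p : {poly R}) (s c t b : R) :
  measurable_fun setT (fun x => p.[sin (s * x + c)] * cos (t * x + b)).
Proof.
apply: continuous_measurable_fun => x.
apply: cvgM; first exact: continuous_horner_sin.
apply: continuous_comp; last exact: continuous_cos.
by apply: cvgD; [exact: mulrl_continuous|exact: cvg_cst].
Qed.

Lemma integrable_horner_sin_cos d (T : measurableType d) (R : realType)
    (P : probability T R) (X : {mfun T >-> R}) (p : {poly R}) (s c t b : R) :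
  P.-integrable setT (EFin \o (fun x => p.[sin (s * X x + c)] * cos (t * X x + b))).
Proof.
have [M pM] := horner_bounded_unit p.
apply: (@probability_bounded_integrable _ _ _ _ _ M).
  exact: (measurableT_comp (measurable_horner_sin_cos p s c t b)).
move=> x; rewrite normrM; apply: le_trans (pM _ (sin_max (s * X x + c))).
by rewrite ler_piMr// cos_max.
Qed.

Lemma integrable_scale d (T : measurableType d) (R : realType) (P : probability T R)
    (f : T -> R) (a : R) :
  P.-integrable setT (EFin \o f) -> P.-integrable setT (EFin \o (fun x => a * f x)).
Proof. by move=> intf; have := @integrableZl _ _ _ P setT measurableT a _ intf. Qed.

Lemma integrable_add d (T : measurableType d) (R : realType) (P : probability T R)
    (f g : T -> R) :
  P.-integrable setT (EFin \o f) -> P.-integrable setT (EFin \o g) ->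
  P.-integrable setT (EFin \o (fun x => f x + g x)).
Proof. by move=> intf intg; have := integrableD measurableT intf intg. Qed.

(* [sin A * cos B] is a half sum of cosines, so powers of a sine are absorbed one at a time
   into the frequency and phase of the cosine factor. *)
Lemma horner_sin_cos_Rintegral_eq d d' (T : measurableType d) (T' : measurableType d')
    (R : realType) (P : probability T R) (Q : probability T' R)
    (X : {mfun T >-> R}) (Y : {mfun T' >-> R}) (p : {poly R}) (s c : R) :
  (forall t, charfun P X t = charfun Q Y t) ->
  forall t b, \int[P]_x (p.[sin (s * X x + c)] * cos (t * X x + b)) =
              \int[Q]_y (p.[sin (s * Y y + c)] * cos (t * Y y + b)).
Proof.
move=> PQ.
have cosE d0 (U : measurableType d0) (S : probability U R) (Z : {mfun U >-> R}) t b :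
    \int[S]_x cos (t * Z x + b) =
    complex.Re (charfun S Z t) * cos b - complex.Im (charfun S Z t) * sin b.
  under eq_Rintegral do rewrite cosD.
  rewrite RintegralB// ?RintegralZr//; try exact: integrable_cos; try exact: integrable_sin.
    by have := @integrableZr _ _ _ S setT measurableT (cos b) _ (integrable_cos S Z t).
  by have := @integrableZr _ _ _ S setT measurableT (sin b) _ (integrable_sin S Z t).
elim/poly_ind: p => [|p a IH] t b.
  by under eq_Rintegral do rewrite horner0 mul0r;
    under [RHS]eq_Rintegral do rewrite horner0 mul0r; rewrite !Rintegral_cst// !mul0r.
(* The product formula for [sin A * cos B] yields sines of [A + B] and [A - B]; the phase [- pi / 2]
   turns them into cosines, so the induction hypothesis applies at the new frequencies and
   phases. *)
have step d0 (U : measurableType d0) (S : probability U R) (Z : {mfun U >-> R}) :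
    \int[S]_x ((p * 'X + a%:P).[sin (s * Z x + c)] * cos (t * Z x + b)) =
    2^-1 * \int[S]_x (p.[sin (s * Z x + c)] * cos ((s + t) * Z x + (c + b - pi / 2))) +
    2^-1 * \int[S]_x (p.[sin (s * Z x + c)] * cos ((s - t) * Z x + (c - b - pi / 2))) +
    a * \int[S]_x (1 * cos (t * Z x + b)).
  have i1 t' b' := integrable_horner_sin_cos S Z p s c t' b'.
  have i2 : S.-integrable setT (EFin \o (fun x => 1 * cos (t * Z x + b))).
    have := integrable_horner_sin_cos S Z 1 s c t b.
    by under eq_fun do rewrite hornerC.
  have i3 := integrable_add
    (integrable_scale 2^-1 (i1 (s + t) (c + b - pi / 2)))
    (integrable_scale 2^-1 (i1 (s - t) (c - b - pi / 2))).
  rewrite -!RintegralZl// -RintegralD//; [|exact: integrable_scale|exact: integrable_scale].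
  rewrite -RintegralD//; last exact: integrable_scale.
  apply: eq_Rintegral => x _; rewrite hornerMXaddC.
  rewrite !addrA !cosBpihalf.
  have -> : (s + t) * Z x + c + b = (s * Z x + c) + (t * Z x + b) by ring.
  have -> : (s - t) * Z x + c - b = (s * Z x + c) - (t * Z x + b) by ring.
  set u := s * Z x + c; set w := t * Z x + b.
  by rewrite [sin (u + w)]sinD [sin (u - w)]sinB; field.
rewrite !step !IH; congr (_ + _ * _).
by under eq_Rintegral do rewrite mul1r; under [RHS]eq_Rintegral do rewrite mul1r;
  rewrite !cosE PQ.
Qed.

Lemma sin_gt0_Rintegral_eq d d' (T : measurableType d) (T' : measurableType d')
    (R : realType) (P : probability T R) (Q : probability T' R)
    (X : {mfun T >-> R}) (Y : {mfun T' >-> R}) (s c : R) :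
  (forall t, charfun P X t = charfun Q Y t) ->
  \int[P]_x (0 < sin (s * X x + c))%R%:R = \int[Q]_y (0 < sin (s * Y y + c))%R%:R :> R.
Proof.
move=> PQ.
apply: (@bounded_limit_Rintegral_eq _ _ _ _ _ _ _ X Y
  (fun n x => (step_poly R n).[sin (s * x + c)]) (fun x => (0 < sin (s * x + c))%R%:R)).
- by move=> n; apply: continuous_measurable_fun; exact: continuous_horner_sin.
- move=> n x; have /andP[p0 p1] := step_poly_ge0_le1 n (sin_max (s * x + c)).
  by rewrite ger0_norm.
- by move=> x; apply: cvg_step_poly; exact: sin_max.
(* Zero frequency and phase make the cosine factor equal to 1. *)
move=> n; have := horner_sin_cos_Rintegral_eq (step_poly R n) s c PQ 0 0.
under eq_Rintegral do rewrite mul0r addr0 cos0 mulr1.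
by under [RHS]eq_Rintegral do rewrite mul0r addr0 cos0 mulr1.
Qed.

(* The indicator of [{sin ((x - a) / n) > 0}] stabilises at that of [{x > a}]. *)
Lemma gt_Rintegral_eq d d' (T : measurableType d) (T' : measurableType d')
    (R : realType) (P : probability T R) (Q : probability T' R)
    (X : {mfun T >-> R}) (Y : {mfun T' >-> R}) (a : R) :
  (forall t, charfun P X t = charfun Q Y t) ->
  \int[P]_x (a < X x)%R%:R = \int[Q]_y (a < Y y)%R%:R :> R.
Proof.
move=> PQ.
apply: (@bounded_limit_Rintegral_eq _ _ _ _ _ _ _ X Y
  (fun n x => (0 < sin (n.+1%:R^-1 * x + - (n.+1%:R^-1 * a)))%R%:R) (fun x => (a < x)%R%:R)).
- move=> n.
  (* The indicator is measurable as a pointwise limit of the continuous step polynomials in the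
     sine. *)
  have mS k : measurable_fun setT
      (fun x : R => (step_poly R k).[sin (n.+1%:R^-1 * x + - (n.+1%:R^-1 * a))]).
    by apply: continuous_measurable_fun; exact: continuous_horner_sin.
  by apply: (measurable_fun_cvg mS) => x _; apply: cvg_step_poly; exact: sin_max.
- by move=> n x; case: (0 < _); rewrite ?normr1 ?normr0.
- move=> x; apply: cvg_near_cst; near=> n.
  rewrite -mulrBr; set y := _ * _; congr (nat_of_bool _)%:R.
  have n0 : 0 < n.+1%:R^-1 :> R by rewrite invr_gt0.
  (* Holds once [n] exceeds the distance from [x] to [a] divided by [pi]; on this range the sine is
     positive exactly when [y] is. *)
  have ypi : `|y| < pi.
    rewrite /y normrM gtr0_norm// mulrC ltr_pdivrMr//.
    apply: lt_trans (_ : pi * n%:R < _); last by rewrite ltr_pM2l ?pi_gt0// ltr_nat.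
    rewrite mulrC -ltr_pdivrMr ?pi_gt0//.
    by near: n; exact: nbhs_infty_gtr.
  move: ypi; rewrite ltr_norml => /andP[y1 y2].
  have [ax|xa] := ltP a x.
    by apply: sin_gt0_pi; rewrite y2 andbT mulr_gt0// subr_gt0.
  apply/negbTE; rewrite -leNgt -oppr_ge0 -sinN; apply: sin_ge0_pi.
  have y0 : y <= 0 by rewrite /y pmulr_rle0// subr_le0.
  by lra.
- move=> n; exact: sin_gt0_Rintegral_eq.
Unshelve. all: by end_near.
Qed.

(** Open upper rays are stable under intersection and generate the Borel sets, and the rays from
    [- n] exhaust the line; on rays the laws agree by [gt_Rintegral_eq]. *)
Lemma charfun_same_law d d' (T : measurableType d) (T' : measurableType d')
    (R : realType) (P : probability T R) (Q : probability T' R)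
    (X : {mfun T >-> R}) (Y : {mfun T' >-> R}) :
  (forall t, charfun P X t = charfun Q Y t) -> same_law P Q X Y.
Proof.
move=> PQ A mA.
have ray d0 (U : measurableType d0) (S : probability U R) (Z : {mfun U >-> R}) (a : R) :
    S (Z @^-1` `]a, +oo[) = (\int[S]_x (a < Z x)%R%:R)%:E.
  have mZ : measurable (Z @^-1` `]a, +oo[).
    by rewrite -[X in measurable X]setTI; exact: measurable_funPT.
  rewrite -[LHS]fineK ?fin_num_measure//; congr _%:E.
  rewrite -[X in S X]setIT -integral_indic//; congr fine; apply: eq_integral => x _.
  congr _%:E; rewrite indicE; congr (nat_of_bool _)%:R.
  by apply/idP/idP => [/set_mem|aZ]; [|apply/mem_set]; rewrite /= in_itv/= andbT.
change (distribution P X A = distribution Q Y A).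
apply: (@measure_unique _ R _ (@RGenOInfty.G R) (fun n => `]- n%:R, +oo[%classic)
  _ _ _ _ (distribution P X) (distribution Q Y) _ _ A mA).
- exact: RGenOInfty.measurableE.
- move=> _ _ [x ->] [y ->]; exists (Num.max x y).
  by apply/seteqP; split => z /=; rewrite !in_itv/= !andbT gt_max => /andP.
- by move=> n; exists (- n%:R).
- apply/seteqP; split => // x _.
  have [n xn] : exists n, - x < n%:R.
    by exists (Num.truncn `|x|).+1; apply: le_lt_trans (truncnS_gt _); rewrite -normrN ler_norm.
  by exists n => //=; rewrite in_itv/= andbT ltrNl.
- move=> _ [a ->]; rewrite /= /distribution /pushforward !ray.
  by rewrite (gt_Rintegral_eq a PQ).
- by move=> k; rewrite ltey_eq fin_num_measure.
Qed.

(** * Ratios of characteristic functions and recovery of the shifts *)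

Lemma charfun_ratio_conj d d' (T : measurableType d) (T' : measurableType d')
    (R : realType) (P : probability T R) (Q : probability T' R)
    (X : {mfun T >-> R}) (Y : {mfun T' >-> R}) (t : R) :
  charfun Q Y (- t) / charfun P X (- t) = conjc (charfun Q Y t / charfun P X t).
Proof. by rewrite !charfunN fmorph_div. Qed.

Lemma ccontinuous_charfun_ratio d d' (T : measurableType d) (T' : measurableType d')
    (R : realType) (P : probability T R) (Q : probability T' R)
    (X : {mfun T >-> R}) (Y : {mfun T' >-> R}) :
  charfun_nowhere_zero P X -> ccontinuous (fun t => charfun Q Y t / charfun P X t).
Proof.
move=> X0; apply: ccontinuousM; first exact: ccontinuous_charfun.
by apply: ccontinuousV => //; exact: ccontinuous_charfun.
Qed.

Lemma charfun_ratio_same_law d d' (T : measurableType d) (T' : measurableType d')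
    (R : realType) (P : probability T R) (Q : probability T' R)
    (X : {mfun T >-> R}) (Y : {mfun T' >-> R}) (c : R) :
  charfun_nowhere_zero P X ->
  (forall t, charfun Q Y t / charfun P X t = cis c t) ->
  same_law Q P Y (fun x => X x + c).
Proof.
move=> X0 E.
have mXc : measurable_fun setT (fun x => X x + c) by exact: measurable_funD.
pose Xc : {mfun T >-> R} := HB.pack (fun x => X x + c) (isMeasurableFun.Build _ _ _ _ _ mXc).
apply: (@charfun_same_law _ _ _ _ _ Q P Y Xc) => t.
by rewrite /= charfun_shift -E mulrC divfK.
Qed.

Theorem theorem2p2 (R : realType) (a2 a3 b2 b3 : R)
  (d : measure_display) (T : measurableType d) (P : probability T R)
  (xi1 xi2 xi3 xi4 : {RV P >-> R})
  (d' : measure_display) (T' : measurableType d') (Q : probability T' R)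
  (eta1 eta2 eta3 eta4 : {RV Q >-> R}) :
  a2 != 0 -> a3 != 0 -> b2 != 0 -> b3 != 0 ->
  [\/ (a2 * b3 != a3 * b2) && (a2 * b2 != - (a3 * b3)),
      (a2 * b3 == a3 * b2) && (`|a2| != `|a3|)
    | (a2 * b3 == a3 * b2) && (a2 == a3)] ->
  mutually_indep4 P xi1 xi2 xi3 xi4 ->
  charfun_nowhere_zero P xi1 -> charfun_nowhere_zero P xi2 ->
  charfun_nowhere_zero P xi3 -> charfun_nowhere_zero P xi4 ->
  same_law P P xi2 xi3 ->
  mutually_indep4 Q eta1 eta2 eta3 eta4 ->
  charfun_nowhere_zero Q eta1 -> charfun_nowhere_zero Q eta2 ->
  charfun_nowhere_zero Q eta3 -> charfun_nowhere_zero Q eta4 ->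
  same_law Q Q eta2 eta3 ->
  same_law P Q
    (fun x => (xi1 x + a2 * xi2 x + a3 * xi3 x, b2 * xi2 x + b3 * xi3 x + xi4 x))
    (fun y => (eta1 y + a2 * eta2 y + a3 * eta3 y, b2 * eta2 y + b3 * eta3 y + eta4 y)) ->
  exists alpha1 alpha2 alpha3 alpha4 : R,
    [/\ same_law Q P eta1 (fun x => xi1 x + alpha1),
        same_law Q P eta2 (fun x => xi2 x + alpha2),
        same_law Q P eta3 (fun x => xi3 x + alpha3)
      & same_law Q P eta4 (fun x => xi4 x + alpha4)].

Proof.
move=> a20 a30 b20 b30 cond indxi xi1_n0 xi2_n0 xi3_n0 xi4_n0 xi23 indeta
  eta1_n0 eta2_n0 eta3_n0 eta4_n0 eta23 LM.
pose h1 t := charfun Q eta1 t / charfun P xi1 t.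
pose h2 t := charfun Q eta2 t / charfun P xi2 t.
pose h4 t := charfun Q eta4 t / charfun P xi4 t.
have h3E t : charfun Q eta3 t / charfun P xi3 t = h2 t.
  by rewrite /h2 (same_law_charfun t xi23) (same_law_charfun t eta23).
have h0 : h2 0 = 1 by rewrite /h2 !charfun0 divr1.
have E u v : h1 u * h2 (a2 * u + b2 * v) * h2 (a3 * u + b3 * v) * h4 v = 1.
  (* This is [u] times the first linear form plus [v] times the second, regrouped by variable. It is
     a function of the pair, so its law is the same on both sides. *)
  pose L d0 (U : measurableType d0) (X1 X2 X3 X4 : {mfun U >-> R}) : {mfun U >-> R} :=
    lin2 1 v (lin2 1 (a3 * u + b3 * v) (lin2 u (a2 * u + b2 * v) X1 X2) X3) X4.
  have LE : same_law P Q (L _ _ xi1 xi2 xi3 xi4) (L _ _ eta1 eta2 eta3 eta4).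
    move=> A mA.
    have mC : measurable ((fun z : R * R => u * z.1 + v * z.2) @^-1` A).
      rewrite -[X in measurable X]setTI.
      have muv : measurable_fun setT (fun z : R * R => u * z.1 + v * z.2).
        by apply: measurable_funD; apply: measurable_funM.
      exact: muv.
    have := LM _ mC; congr (P _ = Q _);
      by apply/funext => x; rewrite /preimage/=; congr (A _); ring.
  have := same_law_charfun 1 LE.
  rewrite /L !mutually_indep4_charfun// => PE.
  rewrite -(h3E (a3 * u + b3 * v)) /h1 /h2 /h4 !mulf_div -PE divff//.
  by rewrite !mulf_neq0.
have [c h2E] : exists c, forall t, h2 t = cis c t.
  apply: (@functional_equation_cis _ a2 a3 b2 b3 h1 h2 h4) => //.
  - exact: ccontinuous_charfun_ratio.
  - by move=> t; rewrite /h2 mulf_neq0 ?invr_eq0.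
  - by move=> t; exact: charfun_ratio_conj.
  - by move=> t; exact: charfun_ratio_conj.
(* With [v = 0] the equation makes [h1] the inverse of the character of frequency [(a2 + a3) * c];
   with [u = 0] it makes [h4] the inverse of that of frequency [(b2 + b3) * c]. *)
exists (- ((a2 + a3) * c)), c, c, (- ((b2 + b3) * c)); split.
- apply: charfun_ratio_same_law => // t; rewrite -/(h1 t).
  have := E t 0; rewrite !mulr0 !addr0 !h2E !cisMx -mulrA.
  have -> : h4 0 = 1 by rewrite /h4 !charfun0 divr1.
  rewrite mulr1 -mulrA -cisDl => H.
  have -> : - ((a2 + a3) * c) = - (c * a2 + c * a3) by ring.
  by rewrite -[LHS]mulr1 -(cisN (c * a2 + c * a3) t) mulrA H mul1r.
- exact: charfun_ratio_same_law.
- by apply: charfun_ratio_same_law => // t; rewrite h3E.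
- apply: charfun_ratio_same_law => // t; rewrite -/(h4 t).
  have := E 0 t; rewrite !mulr0 !add0r !h2E !cisMx.
  have -> : h1 0 = 1 by rewrite /h1 !charfun0 divr1.
  rewrite mul1r -cisDl => H.
  have -> : - ((b2 + b3) * c) = - (c * b2 + c * b3) by ring.
  by rewrite -[LHS]mul1r -(cisN (c * b2 + c * b3) t) mulrAC H mul1r.
Qed.
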